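(* Min-NTDS in a graph $G=(V,E)$ can be approximated within an approximation ratio of $2(\ln(\Delta(G)+1)+1)$; that is, there is a polynomial-time algorithm that, given $G$, outputs a neighborhood total dominating set of $G$ of cardinality at most $2(\ln(\Delta(G)+1)+1)\cdot\gamma_{\rm nt}(G)$.
   Context: $\Delta(G)$ is the maximum degree of $G$. For $S\subseteq V$, $N_G(S)$ is the union of the open neighborhoods of the vertices of $S$. A neighborhood total dominating set of $G$ is a dominating set $D$ of $G$ such that the subgraph $G[N_G(D)]$ has no isolated vertex; $\gamma_{\rm nt}(G)$ is the minimum cardinality of such a set. Min-NTDS is the problem of finding a minimum neighborhood total dominating set. *)

(* Defs.v *)
From mathcomp Require Import all_boot.

Set Implicit Arguments.
Unset Strict Implicit.
Unset Printing Implicit Defensive.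

Local Open Scope nat_scope.

Record sgraph := SGraph {
  vertex :> finType;
  edge : rel vertex;
  edge_sym : symmetric edge;
  edge_irrefl : irreflexive edge }.

Section Graphs.
Variable G : sgraph.
Implicit Types (u v : G) (S D : {set G}).

Definition neigh v : {set G} := [set u | edge v u].

Definition neighs S : {set G} := \bigcup_(v in S) neigh v.

Definition max_degree : nat := \max_(v : G) #|neigh v|.

Definition dominating D : bool :=
  [forall v, (v \notin D) ==> [exists u in D, edge u v]].

Section Induced.
Variable S : {set G}.
Let V : finType := {v : G | v \in S}.
Let e : rel V := fun u v : V => edge (val u) (val v).

Lemma induced_sym : symmetric e.
Proof. by move=> u v; apply: edge_sym. Qed.

Lemma induced_irrefl : irreflexive e.
Proof. by move=> u; apply: edge_irrefl. Qed.

Definition induced : sgraph := SGraph induced_sym induced_irrefl.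
End Induced.
End Graphs.

Definition isolated (G : sgraph) (v : G) : bool := neigh v == set0.

(* neighborhood total dominating set *)
Definition ntds (G : sgraph) (D : {set G}) : bool :=
  dominating D && [forall v : induced (neighs D), ~~ isolated v].

(* In every graph, isolated vertices included, the whole vertex set is an
   NTDS, so the minimum below ranges over a nonempty family. *)
Lemma ntds_setT (G : sgraph) : ntds [set: G].
Proof.
apply/andP; split; first by apply/forallP => v; rewrite inE.
have memN (u v : G) : edge u v -> v \in neighs [set: G].
  by move=> uv; apply/bigcupP; exists u; rewrite inE.
apply/forallP => -[v vN]; apply/set0Pn.
have /bigcupP[u _] := vN; rewrite inE => uv.
have uN : u \in neighs [set: G] by apply: (memN v); rewrite edge_sym.
by exists (Sub u uN); rewrite inE /= edge_sym.
Qed.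

Definition gamma_nt (G : sgraph) : nat :=
  #|[arg min_(D < [set: G] | ntds D) #|D|]|.

Lemma gamma_nt_attained (G : sgraph) :
  exists2 D : {set G}, ntds D & #|D| = gamma_nt G.
Proof.
by rewrite /gamma_nt; case: arg_minnP => [|D DP _]; [exact: ntds_setT|exists D].
Qed.

Lemma gamma_nt_min (G : sgraph) (D : {set G}) : ntds D -> gamma_nt G <= #|D|.
Proof.
by rewrite /gamma_nt; case: arg_minnP => [|D' _]; [exact: ntds_setT|exact].
Qed.

(* Model of computation: the unit-cost random access machine of Cook and
   Reckhow, with a read-once input sequence and a write-once output sequence
   of natural numbers.  Addition and truncated subtraction are the only
   arithmetic instructions, so after t steps every number has O(t) bits more
   than the input numbers and program constants, and polynomial time on this
   machine coincides with polynomial time on Turing machines. *)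
Inductive instr : Type :=
| Const of nat & nat        (* Const r k   : M[r] := k            *)
| Add of nat & nat & nat    (* Add r a b   : M[r] := M[a] + M[b]  *)
| Sub of nat & nat & nat    (* Sub r a b   : M[r] := M[a] - M[b]  *)
| Get of nat & nat          (* Get r a     : M[r] := M[M[a]]      *)
| Put of nat & nat          (* Put a r     : M[M[a]] := M[r]      *)
| Jz of nat & nat           (* Jz r l      : goto l if M[r] = 0   *)
| Read of nat               (* Read r      : M[r] := next input, 0 at the end *)
| Print of nat.             (* Print r     : append M[r] to the output *)

Definition program := seq instr.

Record config := Config {
  pc : nat;
  mem : nat -> nat;
  inp : seq nat;
  out : seq nat }.

Definition upd (m : nat -> nat) (r x : nat) : nat -> nat :=
  fun a => if a == r then x else m a.

Definition exec (i : instr) (c : config) : config :=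
  let: Config p m s o := c in
  match i with
  | Const r k => Config p.+1 (upd m r k) s o
  | Add r a b => Config p.+1 (upd m r (m a + m b)) s o
  | Sub r a b => Config p.+1 (upd m r (m a - m b)) s o
  | Get r a => Config p.+1 (upd m r (m (m a))) s o
  | Put a r => Config p.+1 (upd m (m a) (m r)) s o
  | Jz r l => Config (if m r == 0 then l else p.+1) m s o
  | Read r => Config p.+1 (upd m r (head 0 s)) (behead s) o
  | Print r => Config p.+1 m s (rcons o (m r))
  end.

(* The machine halts when the program counter leaves the program; a halted
   configuration is a fixed point of [step]. *)
Definition halted (P : program) (c : config) : bool := size P <= pc c.

Definition step (P : program) (c : config) : config :=
  if onth P (pc c) is Some i then exec i c else c.

Definition run (P : program) (x : seq nat) (t : nat) : config :=
  iter t (step P) (Config 0 (fun=> 0) x [::]).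

Definition outputs (P : program) (x y : seq nat) : Prop :=
  exists t, halted P (run P x t) /\ out (run P x t) = y.

Definition poly_time (I : Type) (enc : I -> seq nat) (P : program) : Prop :=
  exists c k : nat, forall x : I,
    halted P (run P (enc x) (c * size (enc x) ^ k + c)).

(* The order of the graph followed by its adjacency matrix, row by row: 1 + n^2
   numbers, of which n has at most log n + 1 bits and the others one bit. *)
Definition encode_graph (G : sgraph) : seq nat :=
  #|G| :: [seq nat_of_bool (edge u v) | u <- enum G, v <- enum G].

(* The increasing list of the positions in [enum G] of the elements of D. *)
Definition encode_set (G : sgraph) (D : {set G}) : seq nat :=
  [seq nat_of_ord (enum_rank v) | v <- enum D].

(* Main.v *)
(* A greedy dominating set D, which repeatedly adds a vertex whose closed
   neighborhood contains the most uncovered vertices, has at most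
   H(Delta + 1) <= ln (Delta + 1) + 1 times as many vertices as any dominating set,
   where H(m) is the m-th harmonic number.  Adding a neighbor of each non-isolated
   vertex of D at most doubles it and puts every non-isolated vertex of the graph in
   the neighborhood of the result, so the subgraph induced by that neighborhood has no isolated vertex.

   The algorithm is written in a small language of array programs whose only
   iteration is "for i < n", with bounded sums as expressions.  Its semantics is a
   total function, and every program compiled from it to the random access machine
   runs in time polynomial in n. *)
Require Import Defs.
From mathcomp Require Import all_boot all_order all_algebra.
From mathcomp Require Import zify ring lra.

Set Implicit Arguments.
Unset Strict Implicit.
Unset Printing Implicit Defensive.

(** * Compilation of array programs *)

(** Variables are de Bruijn levels counted from the outermost binder; [ESum] and [CLoop] both bind
    the next level. Multiplication by n is a sum of a constant term, in keeping with a machine that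
    only adds and subtracts. *)
Inductive exp : Type :=
| ECst of nat
| ESize
| EVar of nat
| EArr of exp
| EAdd of exp & exp
| ESub of exp & exp
| ESum of exp.

Inductive cmd : Type :=
| CStore of exp & exp
| CRead of exp
| CPrint of exp & exp
| CSeq of cmd & cmd
| CLoop of cmd.

Fixpoint scoped (d : nat) (e : exp) : bool :=
  match e with
  | ECst _ | ESize => true
  | EVar l => l < d
  | EArr e => scoped d e
  | EAdd e f | ESub e f => scoped d e && scoped d f
  | ESum e => scoped d.+1 e
  end.

Fixpoint cscoped (d : nat) (c : cmd) : bool :=
  match c with
  | CStore e f | CPrint e f => scoped d e && scoped d f
  | CRead e => scoped d e
  | CSeq c c' => cscoped d c && cscoped d c'
  | CLoop c => cscoped d.+1 c
  end.

Fixpoint eval (n : nat) (env : seq nat) (e : exp) (a : nat -> nat) : nat :=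
  match e with
  | ECst k => k
  | ESize => n
  | EVar l => nth 0 env l
  | EArr e => a (eval n env e a)
  | EAdd e f => eval n env e a + eval n env f a
  | ESub e f => eval n env e a - eval n env f a
  | ESum e => \sum_(i < n) eval n (rcons env i) e a
  end.

Record state := State { arr : nat -> nat; sin : seq nat; sout : seq nat }.

Fixpoint sem (n : nat) (env : seq nat) (c : cmd) (st : state) : state :=
  let: State a s w := st in
  match c with
  | CStore e f => State (upd a (eval n env e a) (eval n env f a)) s w
  | CRead e => State (upd a (eval n env e a) (head 0 s)) (behead s) w
  | CPrint e f =>
      if eval n env e a == 0 then st else State a s (rcons w (eval n env f a))
  | CSeq c c' => sem n env c' (sem n env c st)
  | CLoop c => foldl (fun st' i => sem n (rcons env i) c st') st (iota 0 n)
  end.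

(** The count depends on n alone, never on the array. A sum pays per iteration 6 instructions of
    loop control and 1 addition to the accumulator. *)
Fixpoint etime (n : nat) (e : exp) : nat :=
  match e with
  | ECst _ => 1
  | ESize | EVar _ => 2
  | EArr e => etime n e + 3
  | EAdd e f | ESub e f => etime n e + etime n f + 1
  | ESum e => n * (etime n e + 7) + 4
  end.

Fixpoint ctime (n : nat) (c : cmd) : nat :=
  match c with
  | CStore e f => etime n e + etime n f + 3
  | CRead e => etime n e + 4
  | CPrint e f => etime n e + etime n f + 2
  | CSeq c c' => ctime n c + ctime n c'
  | CLoop c => n * (ctime n c + 6) + 3
  end.

(* Entry i of the array lives at address 4 i, temporary p at 4 p + 1, the loop
   variable of level d at 4 d + 2, and the size n at address 3. *)
Definition tmp p := 4 * p + 1.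
Definition var d := 4 * d + 2.

(** Jump targets are absolute, so the body is a function of its load address. The exit test is the
    truncated difference n - i; the jump back is a [Jz] on a temporary that has just been
    cleared. *)
Definition for_code (o d p : nat) (body : nat -> program) : program :=
  let b := body (o + 3) in
  [:: Const (var d) 0; Defs.Sub (tmp p) 3 (var d); Jz (tmp p) (o + 3 + size b + 4)]
  ++ b ++ [:: Const (tmp p) 1; Add (var d) (var d) (tmp p);
              Const (tmp p) 0; Jz (tmp p) o.+1].

(* Code loaded at address o, leaving the value of the expression in temporary p
   and using only temporaries >= p and loop variables of level >= d. *)
Fixpoint ecode (o d p : nat) (e : exp) : program :=
  match e with
  | ECst k => [:: Const (tmp p) k]
  | ESize => [:: Const (tmp p) 0; Add (tmp p) (tmp p) 3]
  | EVar l => [:: Const (tmp p) 0; Add (tmp p) (tmp p) (var l)]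
  | EArr e => ecode o d p e ++ [:: Add (tmp p) (tmp p) (tmp p);
      Add (tmp p) (tmp p) (tmp p); Get (tmp p) (tmp p)]
  | EAdd e f => let c := ecode o d p e in
      c ++ ecode (o + size c) d p.+1 f ++ [:: Add (tmp p) (tmp p) (tmp p.+1)]
  | ESub e f => let c := ecode o d p e in
      c ++ ecode (o + size c) d p.+1 f ++ [:: Defs.Sub (tmp p) (tmp p) (tmp p.+1)]
  | ESum e => Const (tmp p) 0 :: for_code o.+1 d p.+1 (fun o' =>
      ecode o' d.+1 p.+1 e ++ [:: Add (tmp p) (tmp p) (tmp p.+1)])
  end.

Fixpoint ccode (o d : nat) (c : cmd) : program :=
  match c with
  | CStore e f => let ce := ecode o d 0 e in
      ce ++ ecode (o + size ce) d 1 f ++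
      [:: Add (tmp 0) (tmp 0) (tmp 0); Add (tmp 0) (tmp 0) (tmp 0);
          Put (tmp 0) (tmp 1)]
  | CRead e => ecode o d 0 e ++
      [:: Add (tmp 0) (tmp 0) (tmp 0); Add (tmp 0) (tmp 0) (tmp 0);
          Read (tmp 1); Put (tmp 0) (tmp 1)]
  | CPrint e f => let ce := ecode o d 0 e in
      let cf := ecode (o + size ce).+1 d 0 f in
      ce ++ [:: Jz (tmp 0) ((o + size ce).+1 + size cf).+1] ++ cf ++
      [:: Print (tmp 0)]
  | CSeq c c' => let b := ccode o d c in b ++ ccode (o + size b) d c'
  | CLoop c => for_code o d 0 (fun o' => ccode o' d.+1 c)
  end.

(** * Code placement and time-bounded reachability *)

Definition code_at (P : program) (o : nat) (c : program) :=
  exists l r, P = l ++ c ++ r /\ size l = o.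

Lemma code_at_cat P o b c :
  code_at P o (b ++ c) -> code_at P o b /\ code_at P (o + size b) c.
Proof.
move=> [l [r [-> <-]]]; split; first by exists l, (c ++ r); rewrite -!catA.
by exists (l ++ b), r; rewrite -!catA size_cat.
Qed.

Lemma code_at_cons P o i c :
  code_at P o (i :: c) -> onth P o = Some i /\ code_at P o.+1 c.
Proof.
move=> [l [r [-> <-]]]; split; first by rewrite onth_cat ltnn subnn.
by exists (rcons l i), r; rewrite cat_rcons size_rcons.
Qed.

(** Bounding the number of steps, instead of counting them exactly, lets branches of different cost
    share one estimate. *)
Definition reach (P : program) (t : nat) (c c' : config) :=
  exists2 t', t' <= t & iter t' (step P) c = c'.

Lemma reach_refl P t c : reach P t c c.
Proof. by exists 0. Qed.

Lemma reach_pc P t o o' m s w :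
  o = o' -> reach P t (Config o m s w) (Config o' m s w).
Proof. by move=> ->; apply: reach_refl. Qed.

Lemma reach_trans P t1 t2 c1 c2 c3 :
  reach P t1 c1 c2 -> reach P t2 c2 c3 -> reach P (t1 + t2) c1 c3.
Proof.
move=> [u1 h1 <-] [u2 h2 <-]; exists (u2 + u1); last by rewrite iterD.
by rewrite addnC leq_add.
Qed.

Lemma reach_le P t1 t2 c1 c2 : t1 <= t2 -> reach P t1 c1 c2 -> reach P t2 c1 c2.
Proof. by move=> h [t ht e]; exists t => //; apply: leq_trans h. Qed.

Lemma reach_step P o m s w i t c :
  onth P o = Some i -> reach P t (exec i (Config o m s w)) c ->
  reach P t.+1 (Config o m s w) c.
Proof.
move=> Pi [u h <-]; exists u.+1 => //; rewrite iterSr /step /=.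
by rewrite Pi.
Qed.

(** * Memory layout and correctness of the compiled code *)

(** The calling convention for expressions: pending intermediate results and enclosing loop
    variables survive. The four kinds of cells differ modulo 4, so disjointness of addresses is
    plain arithmetic. *)
Definition frame (p d : nat) (m m' : nat -> nat) :=
  [/\ forall i, m' (4 * i) = m (4 * i), m' 3 = m 3,
      forall l, l < d -> m' (var l) = m (var l) &
      forall q, q < p -> m' (tmp q) = m (tmp q)].

Definition mem_rep n env a (m : nat -> nat) :=
  [/\ forall i, m (4 * i) = a i, m 3 = n &
      forall l, l < size env -> m (var l) = nth 0 env l].

Lemma updE m r x : upd m r x r = x.
Proof. by rewrite /upd eqxx. Qed.

Lemma upd_neq m r x b : b != r -> upd m r x b = m b.
Proof. by rewrite /upd => /negPf ->. Qed.

Lemma frame_trans p d m1 m2 m3 :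
  frame p d m1 m2 -> frame p d m2 m3 -> frame p d m1 m3.
Proof.
move=> [a1 b1 c1 d1] [a2 b2 c2 d2]; split=> [i||l h|q h].
- by rewrite a2.
- by rewrite b2.
- by rewrite c2 ?c1.
- by rewrite d2 ?d1.
Qed.

Lemma frameW p d p' d' m m' :
  p <= p' -> d <= d' -> frame p' d' m m' -> frame p d m m'.
Proof.
move=> hp hd [a1 b1 c1 d1]; split=> // [l h|q h].
  by apply: c1; apply: leq_trans hd.
by apply: d1; apply: leq_trans hp.
Qed.

Lemma frame_tmp p d m q x : p <= q -> frame p d m (upd m (tmp q) x).
Proof. by rewrite /frame /tmp /var; split=> *; rewrite upd_neq //; lia. Qed.

Lemma frame_var p d m l x : d <= l -> frame p d m (upd m (var l) x).
Proof. by rewrite /frame /tmp /var; split=> *; rewrite upd_neq //; lia. Qed.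

Lemma frame_rep n env a p m m' :
  frame p (size env) m m' -> mem_rep n env a m -> mem_rep n env a m'.
Proof.
move=> [f1 f2 f3 _] [r1 r2 r3]; split=> [i||l h]; first by rewrite f1.
  by rewrite f2.
by rewrite f3 // r3.
Qed.

Lemma mem_rep_rcons n env a m x :
  mem_rep n env a m -> m (var (size env)) = x -> mem_rep n (rcons env x) a m.
Proof.
move=> [r1 r2 r3] h; split=> // l; rewrite size_rcons nth_rcons ltnS leq_eqVlt.
by case/predU1P=> [->|lt]; rewrite ?ltnn ?eqxx // lt r3.
Qed.

(* A loop invariant may not depend on temporaries >= p nor on the loop variable
   of level d, which the loop control code overwrites. *)
Lemma for_codeP P o d p n T body (I : nat -> (nat -> nat) -> seq nat -> seq nat -> Prop)
    m s w :
  code_at P o (for_code o d p body) ->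
  (forall k m m' s w, frame p d m m' -> I k m s w -> I k m' s w) ->
  (forall k m s w, I k m s w -> m 3 = n) ->
  (forall k m s w, k < n -> I k m s w -> m (var d) = k ->
     exists m' s' w', [/\ reach P T (Config (o + 3) m s w)
         (Config (o + 3 + size (body (o + 3))) m' s' w'),
       I k.+1 m' s' w' & m' (var d) = k]) ->
  I 0 m s w ->
  exists m' s' w', reach P (n * (T + 6) + 3) (Config o m s w)
     (Config (o + size (for_code o d p body)) m' s' w') /\ I n m' s' w'.
Proof.
rewrite /for_code; set b := body (o + 3).
move=> /code_at_cat[/code_at_cons[c0 /code_at_cons[c1 /code_at_cons[c2 _]]]].
move=> /code_at_cat[_ /code_at_cons[c3 /code_at_cons[c4 /code_at_cons[c5]]]].
move=> /code_at_cons[c6 _] Ifr I3 Ibody I0.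
(* Induction on the number j of remaining iterations, starting at the loop test. An iteration costs
   2 for the test, T for the body and 4 for the increment and jump; the last 2 pay for the final
   test. *)
have main j k m1 s1 w1 : k + j = n -> I k m1 s1 w1 -> m1 (var d) = k ->
    exists m' s' w', reach P (j * (T + 6) + 2) (Config o.+1 m1 s1 w1)
      (Config (o + 3 + size b + 4) m' s' w') /\ I n m' s' w'.
  elim: j k m1 s1 w1 => [|j IHj] k m1 s1 w1.
    rewrite addn0 => -> In kn; exists (upd m1 (tmp p) 0), s1, w1.
    split; last by apply: (Ifr _ m1) => //; apply: frame_tmp.
    apply: (reach_step c1); apply: (reach_step c2) => /=.
    rewrite (I3 _ _ _ _ In) kn subnn updE eqxx; exact: reach_refl.
  move=> kj Ik mk; have lt : k < n by lia.
  pose m2 := upd m1 (tmp p) (n - k).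
  have I2 : I k m2 s1 w1 by apply: (Ifr _ m1) => //; apply: frame_tmp.
  have m2k : m2 (var d) = k by rewrite /m2 upd_neq // /var /tmp; lia.
  have [m3 [s3 [w3 [r3 I3' m3k]]]] := Ibody _ _ _ _ lt I2 m2k.
  pose m4 := upd (upd (upd m3 (tmp p) 1) (var d) k.+1) (tmp p) 0.
  have I4 : I k.+1 m4 s3 w3.
    apply: (Ifr _ m3) => //.
    apply: frame_trans (frame_tmp _ _ _ (leqnn p)).
    apply: frame_trans (frame_var _ _ _ (leqnn d)).
    exact: frame_tmp.
  have m4k : m4 (var d) = k.+1.
    by rewrite /m4 upd_neq ?updE // /var /tmp; lia.
  have [m5 [s5 [w5 [r5 I5]]]] := IHj _ _ _ _ (etrans (addSnnS k j) kj) I4 m4k.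
  exists m5, s5, w5; split=> //.
  apply: (@reach_le _ (2 + (T + (4 + (j * (T + 6) + 2))))); first lia.
  apply: (reach_step c1); apply: (reach_step c2) => /=.
  rewrite (I3 _ _ _ _ Ik) mk updE subn_eq0 leqNgt lt /=.
  have -> : o.+3 = o + 3 by lia.
  apply: reach_trans r3 _.
  apply: (reach_step c3); apply: (reach_step c4); apply: (reach_step c5).
  apply: (reach_step c6).
  rewrite /= !updE eqxx upd_neq ?m3k ?addn1 //.
  by rewrite /var /tmp; lia.
have fr : frame p d m (upd m (var d) 0) by apply: frame_var.
have [m' [s' [w' [r Im]]]] := main n 0 _ _ _ erefl (Ifr _ _ _ _ _ fr I0) (updE _ _ _).
exists m', s', w'; split=> //.
apply: (@reach_le _ (1 + (n * (T + 6) + 2))); first lia.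
apply: (reach_step c0) => /=.
rewrite size_cat /=.
have -> : o + (size b + 4).+3 = o + 3 + size b + 4 by lia.
exact: r.
Qed.

(** Induction on the expression. A second operand is evaluated into temporary p + 1, and its frame
    condition keeps the first operand in temporary p. *)
Lemma ecodeP P n e o env p a m s w :
  code_at P o (ecode o (size env) p e) -> scoped (size env) e ->
  mem_rep n env a m ->
  exists m', [/\ reach P (etime n e) (Config o m s w)
      (Config (o + size (ecode o (size env) p e)) m' s w),
    m' (tmp p) = eval n env e a & frame p (size env) m m'].
Proof.
elim: e o env p m s w => [k||l|e IHe|e IHe f IHf|e IHe f IHf|e IHe] /= o env p m s w.
- move=> /code_at_cons[c0 _] _ _; exists (upd m (tmp p) k).
  rewrite updE addn1; split=> //; last exact: frame_tmp.
  by apply: (reach_step c0); apply: reach_refl.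
- move=> /code_at_cons[c0 /code_at_cons[c1 _]] _ [_ r3 _].
  exists (upd (upd m (tmp p) 0) (tmp p) n).
  rewrite updE addn2; split=> //.
    apply: (reach_step c0); apply: (reach_step c1) => /=.
    rewrite updE upd_neq ?r3 ?add0n; last by rewrite /tmp; lia.
    exact: reach_refl.
  by apply: frame_trans (frame_tmp _ _ _ (leqnn p)); apply: frame_tmp.
- move=> /code_at_cons[c0 /code_at_cons[c1 _]] ls [_ _ rv].
  exists (upd (upd m (tmp p) 0) (tmp p) (nth 0 env l)).
  rewrite updE addn2; split=> //.
    apply: (reach_step c0); apply: (reach_step c1) => /=.
    rewrite updE upd_neq ?rv ?add0n //; last by rewrite /tmp /var; lia.
    exact: reach_refl.
  by apply: frame_trans (frame_tmp _ _ _ (leqnn p)); apply: frame_tmp.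
- move=> /code_at_cat[ce /code_at_cons[c0 /code_at_cons[c1 /code_at_cons[c2 _]]]].
  move=> sc rep; have [m1 [r1 v1 f1]] := IHe _ _ _ _ s w ce sc rep.
  have [ra _ _] := frame_rep f1 rep.
  set v := eval n env e a in v1 *.
  exists (upd (upd (upd m1 (tmp p) (v + v)) (tmp p) (v + v + (v + v))) (tmp p) (a v)).
  rewrite updE; split=> //.
    apply: reach_trans r1 _.
    apply: (reach_step c0); apply: (reach_step c1); apply: (reach_step c2) => /=.
    rewrite size_cat addnA addn3 !updE v1.
    have -> : v + v + (v + v) = 4 * v by lia.
    rewrite !upd_neq ?ra; try by rewrite /tmp; lia.
    exact: reach_refl.
  apply: frame_trans (frame_tmp _ _ _ (leqnn p)).
  apply: frame_trans (frame_tmp _ _ _ (leqnn p)).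
  by apply: frame_trans (frame_tmp _ _ _ (leqnn p)).
- move=> /code_at_cat[ce /code_at_cat[cf /code_at_cons[c0 _]]].
  move=> /andP[sce scf] rep.
  have [m1 [r1 v1 f1]] := IHe _ _ _ _ s w ce sce rep.
  have rep1 := frame_rep f1 rep.
  have [m2 [r2 v2 f2]] := IHf _ _ _ _ s w cf scf rep1.
  exists (upd m2 (tmp p) (eval n env e a + eval n env f a)).
  rewrite updE; split=> //.
    apply: reach_trans (reach_trans r1 r2) _; apply: (reach_step c0) => /=.
    case: f2 => _ _ _ /(_ p (ltnSn p)) ->; rewrite v1 v2 !size_cat /=.
    by rewrite !addnA addn1; apply: reach_refl.
  apply: frame_trans (frame_tmp _ _ _ (leqnn p)).
  exact: frame_trans f1 (frameW (leqnSn p) (leqnn _) f2).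
- move=> /code_at_cat[ce /code_at_cat[cf /code_at_cons[c0 _]]].
  move=> /andP[sce scf] rep.
  have [m1 [r1 v1 f1]] := IHe _ _ _ _ s w ce sce rep.
  have rep1 := frame_rep f1 rep.
  have [m2 [r2 v2 f2]] := IHf _ _ _ _ s w cf scf rep1.
  exists (upd m2 (tmp p) (eval n env e a - eval n env f a)).
  rewrite updE; split=> //.
    apply: reach_trans (reach_trans r1 r2) _; apply: (reach_step c0) => /=.
    case: f2 => _ _ _ /(_ p (ltnSn p)) ->; rewrite v1 v2 !size_cat /=.
    by rewrite !addnA addn1; apply: reach_refl.
  apply: frame_trans (frame_tmp _ _ _ (leqnn p)).
  exact: frame_trans f1 (frameW (leqnSn p) (leqnn _) f2).
- move=> /code_at_cons[c0 cl] sc rep.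
  (* Temporary p accumulates the partial sum; the summand and the loop control work in temporaries
     above p. *)
  pose I k (m1 : nat -> nat) (s1 w1 : seq nat) :=
    [/\ s1 = s, w1 = w, frame p (size env) m m1 &
        m1 (tmp p) = \sum_(i < k) eval n (rcons env i) e a].
  have [||k m1 s1 w1 kn [-> -> f1 v1] m1k||m1 [s1 [w1 [r1 [es ew f1 v1]]]]] :=
      @for_codeP P o.+1 (size env) p.+1 n (etime n e).+1 _ I
        (upd m (tmp p) 0) s w cl.
  + move=> k m1 m2 s1 w1 f12 [-> -> f1 v1]; split=> //.
      exact: frame_trans f1 (frameW (leqnSn p) (leqnn _) f12).
    by case: f12 => _ _ _ ->.
  + by move=> k m1 s1 w1 [_ _ /frame_rep-/(_ _ _ rep)[]].
  + have := mem_rep_rcons (frame_rep f1 rep) m1k.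
    have [_ /code_at_cat[cb _]] := code_at_cat cl.
    have [ce /code_at_cons[c1 _]] := code_at_cat cb.
    rewrite -(size_rcons env k) in ce sc c1 => rep1.
    have [m2 [r2 v2 f2]] := IHe _ _ _ _ s w ce sc rep1.
    exists (upd m2 (tmp p) (\sum_(i < k.+1) eval n (rcons env i) e a)), s, w.
    have p2 : m2 (tmp p) = \sum_(i < k) eval n (rcons env i) e a.
      by case: f2 => _ _ _ ->.
    split.
    * rewrite -(size_rcons env k) -[(etime n e).+1]addn1.
      apply: reach_trans r2 _.
      apply: (reach_step c1) => /=; rewrite big_ord_recr /= p2 v2 size_cat /=.
      by rewrite addnA addn1; apply: reach_refl.
    * split=> //; last by rewrite updE.
      apply: frame_trans (frame_tmp _ _ _ (leqnn p)).
      apply: (frame_trans f1); apply: frameW f2 => //.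
      by rewrite size_rcons.
    * rewrite upd_neq; last by rewrite /tmp /var; lia.
      by case: f2 => _ _ ->; rewrite ?size_rcons.
  + by split; rewrite ?updE ?big_ord0 //; apply: frame_tmp.
  rewrite es ew in r1; exists m1; split=> //.
  have -> : n * (etime n e + 7) + 4 = (n * ((etime n e).+1 + 6) + 3).+1 by lia.
  by have := reach_step c0 r1; rewrite [o.+1 + _]addSn -[(o + _).+1]addnS.
Qed.

Lemma foldl_iotaS (A : Type) (f : A -> nat -> A) x k :
  foldl f x (iota 0 k.+1) = f (foldl f x (iota 0 k)) k.
Proof. by rewrite -addn1 iotaD foldl_cat. Qed.

(** Unlike expressions, commands promise only [mem_rep]: no temporary is carried from one command to
    the next, so each starts afresh at temporary 0. *)
Lemma ccodeP P n c o env a m s w :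
  code_at P o (ccode o (size env) c) -> cscoped (size env) c ->
  mem_rep n env a m ->
  let st := sem n env c (State a s w) in
  exists m', reach P (ctime n c) (Config o m s w)
      (Config (o + size (ccode o (size env) c)) m' (sin st) (sout st)) /\
    mem_rep n env (arr st) m'.
Proof.
elim: c o env a m s w => [e f|e|e f|c1 IH1 c2 IH2|c IHc] /= o env a m s w.
- move=> /code_at_cat[ce /code_at_cat[cf]].
  move=> /code_at_cons[c0 /code_at_cons[c1 /code_at_cons[c2 _]]].
  move=> /andP[sce scf] rep.
  have [m1 [r1 v1 f1]] := ecodeP s w ce sce rep.
  have rep1 := frame_rep f1 rep.
  have [m2 [r2 v2 f2]] := ecodeP s w cf scf rep1.
  have rep2 := frame_rep f2 rep1.
  set u := eval n env e a in v1 *; set v := eval n env f a in v2 *.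
  have m20 : m2 (tmp 0) = u by case: f2 => _ _ _ ->.
  pose m3 := upd (upd m2 (tmp 0) (u + u)) (tmp 0) (4 * u).
  have f3 : frame 0 (size env) m2 m3.
    apply: frame_trans (frame_tmp _ _ _ (leqnn 0)); exact: frame_tmp.
  have [ra r3 rv] := frame_rep f3 rep2.
  exists (upd m3 (4 * u) v); split.
    apply: reach_trans (reach_trans r1 r2) _.
    apply: (reach_step c0); apply: (reach_step c1); apply: (reach_step c2) => /=.
    rewrite !updE m20 (_ : u + u + (u + u) = 4 * u); last lia.
    rewrite upd_neq // upd_neq // v2 !size_cat /= !addnA addn3.
    exact: reach_refl.
  split=> [i||l lt].
  + by rewrite /upd eqn_mul2l /= -/m3 ra.
  + by rewrite upd_neq //; lia.
  + by rewrite upd_neq ?rv // /var; lia.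
- move=> /code_at_cat[ce /code_at_cons[c0 /code_at_cons[c1]]].
  move=> /code_at_cons[c2 /code_at_cons[c3 _]].
  move=> sce rep.
  have [m1 [r1 v1 f1]] := ecodeP s w ce sce rep.
  have rep1 := frame_rep f1 rep.
  set u := eval n env e a in v1 *.
  pose m3 := upd (upd (upd m1 (tmp 0) (u + u)) (tmp 0) (4 * u)) (tmp 1) (head 0 s).
  have f3 : frame 0 (size env) m1 m3.
    apply: frame_trans (frame_tmp _ _ _ (leq0n 1)).
    apply: frame_trans (frame_tmp _ _ _ (leqnn 0)); exact: frame_tmp.
  have [ra r3 rv] := frame_rep f3 rep1.
  exists (upd m3 (4 * u) (head 0 s)); split.
    apply: reach_trans r1 _.
    apply: (reach_step c0); apply: (reach_step c1); apply: (reach_step c2).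
    apply: (reach_step c3) => /=.
    rewrite !updE v1 (_ : u + u + (u + u) = 4 * u); last lia.
    rewrite (upd_neq _ _ (_ : tmp 0 != tmp 1)) // updE.
    rewrite size_cat /= addnA addn4.
    exact: reach_refl.
  split=> [i||l lt].
  + by rewrite /upd eqn_mul2l /= -/m3 ra.
  + by rewrite upd_neq //; lia.
  + by rewrite upd_neq ?rv // /var; lia.
- move=> /code_at_cat[ce /code_at_cons[c0 /code_at_cat[cf /code_at_cons[c1 _]]]].
  move=> /andP[sce scf] rep.
  have [m1 [r1 v1 f1]] := ecodeP s w ce sce rep.
  have rep1 := frame_rep f1 rep.
  rewrite size_cat /= size_cat /=.
  case: eqP => ev /=.
    exists m1; split=> //.
    apply: (@reach_le _ (etime n e + 1)); first lia.
    apply: reach_trans r1 _; apply: (reach_step c0) => /=.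
    rewrite v1 ev eqxx.
    by apply: reach_pc; lia.
  have [m2 [r2 v2 f2]] := ecodeP s w cf scf rep1.
  exists m2; split; last exact: frame_rep f2 rep1.
  apply: (@reach_le _ (etime n e + (1 + (etime n f + 1)))); first lia.
  apply: reach_trans r1 _; apply: (reach_step c0) => /=.
  rewrite v1 (negPf (introN eqP ev)).
  apply: reach_trans r2 _; apply: (reach_step c1) => /=.
  by rewrite v2; apply: reach_pc; lia.
- move=> /code_at_cat[k1 k2] /andP[sc1 sc2] rep.
  have [m1 [r1 rep1]] := IH1 _ _ _ _ s w k1 sc1 rep.
  have [m2 [r2 rep2]] := IH2 _ _ _ _ (sin (sem n env c1 (State a s w)))
    (sout (sem n env c1 (State a s w))) k2 sc2 rep1.
  move: r1 rep1 r2 rep2; case: (sem n env c1 _) => a1 s1 w1 /= r1 rep1 r2 rep2.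
  exists m2; split=> //; rewrite size_cat addnA; exact: reach_trans r1 r2.
- move=> cl sc rep.
  pose F st' i := sem n (rcons env i) c st'.
  pose I k (m1 : nat -> nat) (s1 w1 : seq nat) :=
    exists a1, State a1 s1 w1 = foldl F (State a s w) (iota 0 k) /\
      mem_rep n env a1 m1.
  have [||k m1 s1 w1 kn [a1 [E1 rep1]] m1k||m1 [s1 [w1 [r1 [a1 [<- rep1]]]]]] :=
      @for_codeP P o (size env) 0 n (ctime n c) _ I m s w cl.
  + move=> k m1 m2 s1 w1 f12 [a1 [E1 rep1]]; exists a1; split=> //.
    exact: frame_rep f12 rep1.
  + by move=> k m1 s1 w1 [a1 [_ []]].
  + have [_ /code_at_cat[cb _]] := code_at_cat cl.
    rewrite -(size_rcons env k) in cb sc *.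
    have [m2 [r2 [ra r3 rv]]] := IHc _ _ _ _ s1 w1 cb sc (mem_rep_rcons rep1 m1k).
    exists m2; eexists; eexists; split; first exact: r2.
      exists (arr (sem n (rcons env k) c (State a1 s1 w1))); split.
        by rewrite foldl_iotaS -E1 /F; case: (sem _ _ _ _).
      split=> // l lt; rewrite rv ?nth_rcons ?lt //.
      by rewrite size_rcons ltnW.
    by rewrite rv ?size_rcons // nth_rcons ltnn eqxx.
  + by exists a.
  by exists m1.
Qed.

(** The first input number, the order of the graph, is put where the code expects n. *)
Definition compile (c : cmd) : program := Read 3 :: ccode 1 0 c.

Lemma compileP (c : cmd) (n : nat) (x : seq nat) : cscoped 0 c ->
  exists2 t, t <= (ctime n c).+1 &
    halted (compile c) (run (compile c) (n :: x) t) /\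
    out (run (compile c) (n :: x) t) =
      sout (sem n [::] c (State (fun=> 0) x [::])).
Proof.
move=> sc.
have rep : mem_rep n [::] (fun=> 0) (upd (fun=> 0) 3 n).
  by split=> // i; rewrite upd_neq //; lia.
have at1 : code_at (compile c) 1 (ccode 1 (size (Nil nat)) c).
  by exists [:: Read 3], [::]; rewrite cats0.
have [m' [[t ht E] _]] := ccodeP x [::] at1 sc rep.
exists t.+1 => //.
have -> : run (compile c) (n :: x) t.+1 =
  iter t (step (compile c)) (Config 1 (upd (fun=> 0) 3 n) x [::]).
  by rewrite /run iterSr.
by rewrite E /halted /=.
Qed.

(** * Polynomial running time *)

(** The base n + 1 is never 0, so raising the exponent never lowers the bound; this makes the class
    closed under sums and products. *)
Definition poly_bounded (f : nat -> nat) :=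
  exists c k, forall n, f n <= c * n.+1 ^ k.

Lemma poly_bounded_cst c : poly_bounded (fun=> c).
Proof. by exists c, 0 => n; rewrite expn0 muln1. Qed.

Lemma poly_bounded_id : poly_bounded id.
Proof. by exists 1, 1 => n; rewrite mul1n expn1. Qed.

Lemma poly_boundedD f g :
  poly_bounded f -> poly_bounded g -> poly_bounded (fun n => f n + g n).
Proof.
move=> [c [k hf]] [c' [k' hg]]; exists (c + c'), (k + k') => n.
rewrite mulnDl; apply: leq_add.
  by apply: leq_trans (hf n) _; rewrite leq_mul2l leq_pexp2l ?orbT // leq_addr.
by apply: leq_trans (hg n) _; rewrite leq_mul2l leq_pexp2l ?orbT // leq_addl.
Qed.

Lemma poly_boundedM f g :
  poly_bounded f -> poly_bounded g -> poly_bounded (fun n => f n * g n).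
Proof.
move=> [c [k hf]] [c' [k' hg]]; exists (c * c'), (k + k') => n.
by rewrite expnD mulnACA; apply: leq_mul.
Qed.

Lemma poly_bounded_etime e : poly_bounded (etime ^~ e).
Proof.
elim: e => /=; intros; repeat first
  [apply: poly_boundedD | apply: poly_boundedM | apply: poly_bounded_id
  | apply: poly_bounded_cst | assumption].
Qed.

Lemma poly_bounded_ctime c : poly_bounded (ctime ^~ c).
Proof.
elim: c => /=; intros; repeat first
  [apply: poly_boundedD | apply: poly_boundedM | apply: poly_bounded_id
  | apply: poly_bounded_etime | apply: poly_bounded_cst | assumption].
Qed.

Lemma halted_iter P c t : halted P c -> iter t (step P) c = c.
Proof.
move=> h; elim: t => //= t ->; rewrite /step.
by rewrite onth_default.
Qed.

Lemma halted_run_le P x t u : t <= u ->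
  halted P (run P x t) -> halted P (run P x u).
Proof. by move=> /subnK <- h; rewrite /run iterD halted_iter. Qed.

Lemma size_encode_graph (G : sgraph) : size (encode_graph G) = (#|G| ^ 2).+1.
Proof. by rewrite /= size_allpairs -cardE -mulnn. Qed.

(** The input has n^2 + 1 numbers and n + 1 <= 2 (n^2 + 1), which turns a bound C (n + 1)^k into C
    2^k (n^2 + 1)^k. *)
Lemma compile_poly_time c : cscoped 0 c -> poly_time encode_graph (compile c).
Proof.
move=> sc.
have [C [k hC]] : poly_bounded (fun n => (ctime n c).+1).
  have [C [k h]] := poly_boundedD (poly_bounded_ctime c) (poly_bounded_cst 1).
  by exists C, k => n; rewrite -addn1.
exists (C * 2 ^ k), k => G.
have [t ht [H _]] := compileP #|G| (behead (encode_graph G)) sc.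
apply: halted_run_le H; apply: leq_trans ht _.
apply: leq_trans (hC _) _; rewrite size_encode_graph.
apply: leq_trans (leq_addr _ _); rewrite -mulnA -expnMn leq_mul2l.
apply/orP; right; case: k {hC} => // k; rewrite leq_exp2r // -mulnn.
by case: #|G| => // n; rewrite mulSn; lia.
Qed.

(** * The greedy dominating set *)

Lemma leq_card_bigcup (I T : finType) (A : {set I}) (F : I -> {set T}) :
  #|\bigcup_(i in A) F i| <= \sum_(i in A) #|F i|.
Proof.
elim/big_rec2: _ => [|i n X _ le]; first by rewrite cards0.
by apply: leq_trans (leq_card_setU _ _) _; rewrite leq_add2l.
Qed.

Section Greedy.
Variable G : sgraph.
Implicit Types (u v w : G) (S D : {set G}).

Definition cneigh v : {set G} := v |: neigh v.

Definition uncovered D : {set G} := ~: \bigcup_(u in D) cneigh u.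

Definition score D v := #|cneigh v :&: uncovered D|.

Definition best D v := (0 < score D v) && [forall w, score D w <= score D v].

(** Ties are left open, so the ratio holds for whatever choices the program makes, including several
    within one pass. *)
Inductive greedy : {set G} -> Prop :=
| Greedy0 : greedy set0
| GreedyU D v : greedy D -> best D v -> greedy (v |: D).

Lemma cneigh_id v : v \in cneigh v.
Proof. exact: setU11. Qed.

Lemma card_cneigh v : #|cneigh v| <= (max_degree G).+1.
Proof.
rewrite cardsU1 -add1n; apply: leq_add; first exact: leq_b1.
exact: (leq_bigmax v).
Qed.

Lemma dominatingE D : dominating D = (uncovered D == set0).
Proof.
apply/forallP/eqP => [dom|unc v].
  apply/setP => v; rewrite !inE; apply/negbTE; rewrite negbK; apply/bigcupP.
  have [vD|vD] := boolP (v \in D); first by exists v; rewrite ?cneigh_id.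
  by have /implyP/(_ vD)/exists_inP[u uD uv] := dom v; exists u; rewrite // !inE uv orbT.
apply/implyP => vD; have : v \notin uncovered D by rewrite unc inE.
rewrite !inE negbK => /bigcupP[u uD]; rewrite !inE => /predU1P[vu|uv].
  by rewrite vu uD in vD.
by apply/exists_inP; exists u.
Qed.

Lemma uncoveredU1 v D : uncovered (v |: D) = uncovered D :\: cneigh v.
Proof. by rewrite /uncovered bigcup_setU big_set1 setCU setIC setDE. Qed.

Lemma uncoveredS D D' : D \subset D' -> uncovered D' \subset uncovered D.
Proof.
move=> sub; rewrite setCS; apply/bigcupsP => u uD.
by apply: bigcup_sup; apply: (subsetP sub).
Qed.

Lemma uncovered_setT : uncovered [set: G] = set0.
Proof.
apply/eqP; rewrite -dominatingE; apply/forallP => v; by rewrite inE.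
Qed.

(** The uncovered part of the closed neighborhood of w is split by membership in that of v. *)
Lemma score_setU1 v D w :
  score D w = score (v |: D) w + #|cneigh w :&: (cneigh v :&: uncovered D)|.
Proof.
rewrite /score uncoveredU1 addnC -(cardsID (cneigh v) (cneigh w :&: uncovered D)).
by rewrite -setIA (setIC (uncovered D)) setIDA.
Qed.

(** The closed neighborhoods of the members of S cover the graph, in particular the vertices that v
    would newly cover; the rest is a union bound. *)
Lemma score_best_le S D v : dominating S ->
  score D v <= \sum_(s in S) #|cneigh s :&: (cneigh v :&: uncovered D)|.
Proof.
move=> domS; apply: leq_trans (leq_card_bigcup _ _); apply: subset_leq_card.
apply/subsetP => x xX; move: domS; rewrite dominatingE => /eqP/setP/(_ x).
rewrite !inE => /negbFE/bigcupP[s sS xs]; apply/bigcupP; exists s => //.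
by rewrite inE xs.
Qed.

Lemma exists_best D : uncovered D != set0 -> exists v, best D v.
Proof.
case/set0Pn => x xU.
have sx : 0 < score D x.
  by apply/card_gt0P; exists x; rewrite inE cneigh_id.
pose v := [arg max_(w > x) score D w].
have max w : score D w <= score D v by rewrite /v; case: arg_maxnP => // i _; apply.
by exists v; rewrite /best (leq_trans sx) //; apply/forallP.
Qed.

(** The closed neighborhood of a member of D is entirely covered, so its score is 0. Hence the
    program may add the two truth values to form a disjunction. *)
Lemma best_notin D v : best D v -> v \notin D.
Proof.
case/andP=> /card_gt0P[x]; rewrite !inE => /andP[xv /bigcupP nx] _.
by apply/negP => vD; apply: nx; exists v; rewrite // !inE.
Qed.

(** * Extension to a neighborhood total dominating set *)

Definition first_neigh u v :=
  edge u v && [forall w, (enum_rank w < enum_rank v) ==> ~~ edge u w].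

Definition total_ext D := D :|: \bigcup_(u in D) [set v | first_neigh u v].

(** Each u in D contributes at most one vertex, since of two first neighbors neither can precede the
    other in the enumeration. *)
Lemma card_total_ext D : #|total_ext D| <= 2 * #|D|.
Proof.
apply: leq_trans (leq_card_setU _ _) _; rewrite mul2n -addnn leq_add2l.
apply: leq_trans (leq_card_bigcup _ _) _; rewrite -sum1_card; apply: leq_sum => u _.
apply/card_le1_eqP => x y; rewrite !inE => /andP[ux /forallP fx] /andP[uy /forallP fy].
apply/enum_rank_inj/val_inj/eqP; rewrite /= eqn_leq.
have := fx y; have := fy x; rewrite ux uy !implybF -!leqNgt.
by move=> -> ->.
Qed.

Lemma exists_first_neigh u v : edge u v -> exists w, first_neigh u w.
Proof.
move=> uv; have [w uw wP] := @arg_minnP G v (edge u) (fun w => enum_rank w) uv.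
exists w; rewrite /first_neigh uw; apply/forallP => x; apply/implyP => lt.
by apply: contraL lt => /wP; rewrite -leqNgt.
Qed.

Lemma ntds_total_ext D : dominating D -> ntds (total_ext D).
Proof.
move=> domD; have sub : D \subset total_ext D by apply: subsetUl.
(* Every non-isolated x is reached: from its own first neighbor if x is in D, from a dominating
   vertex otherwise. The neighbors of a vertex of the induced subgraph are non-isolated as well, so
   they also belong to it. *)
have nbr x y : edge x y -> x \in neighs (total_ext D).
  move=> xy; have [xD|xD] := boolP (x \in D).
    have [w /[dup] xw /andP[ew _]] := exists_first_neigh xy.
    apply/bigcupP; exists w; last by rewrite inE edge_sym.
    by rewrite inE; apply/orP; right; apply/bigcupP; exists x; rewrite ?inE.
  have /forallP/(_ x)/implyP/(_ xD)/exists_inP[u uD ux] := domD.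
  by apply/bigcupP; exists u; [apply: (subsetP sub) | rewrite inE].
apply/andP; split.
  rewrite dominatingE -subset0; move: domD; rewrite dominatingE => /eqP <-.
  exact: uncoveredS.
apply/forallP => -[v vN]; apply/set0Pn.
have /bigcupP[u _] := vN; rewrite inE => uv.
by exists (eqtype.Sub u (nbr _ _ uv)); rewrite inE /= edge_sym.
Qed.

End Greedy.

(** * Harmonic potential and the greedy ratio *)

Section Potential.
Import Order.TTheory GRing.Theory Num.Theory.
Local Open Scope ring_scope.
Variable R : realFieldType.

Definition harmonic_sum (n : nat) : R := \sum_(i < n) i.+1%:R^-1.

Lemma harmonic_sum_ge0 n : 0 <= harmonic_sum n.
Proof. by apply: sumr_ge0 => i _; rewrite invr_ge0 ler0n. Qed.

(** The b terms 1/(a+1), ..., 1/(a+b) are each at least 1/m. *)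
Lemma harmonic_sumD_ge m a b : (a + b <= m)%N ->
  harmonic_sum a + b%:R / m%:R <= harmonic_sum (a + b)%N.
Proof.
elim: b => [|b IHb] le; first by rewrite mul0r addr0 addn0.
rewrite addnS /harmonic_sum big_ord_recr /= -/(harmonic_sum _) -natr1 mulrDl addrA.
apply: lerD; first by apply: IHb; lia.
by rewrite mul1r lef_pV2 ?posrE ?ltr0n ?ler_nat; lia.
Qed.

Lemma le_harmonic_sum a b : (a <= b)%N -> harmonic_sum a <= harmonic_sum b.
Proof.
move=> /subnKC <-; apply: le_trans (@harmonic_sumD_ge (a + (b - a)) _ _ (leqnn _)).
by rewrite lerDl divr_ge0 ?ler0n.
Qed.

(* Each greedy choice lowers the potential, the sum over s in S of H(number of
   uncovered vertices in the closed neighborhood of s), by at least 1. *)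
Lemma greedy_potential (G : sgraph) (S D : {set G}) :
  dominating S -> greedy D ->
  #|D|%:R + \sum_(s in S) harmonic_sum (score D s)
    <= \sum_(s in S) harmonic_sum #|cneigh s|.
Proof.
move=> domS; elim=> [|{}D v _ IH /andP[m0 /forallP mx]].
  rewrite cards0 add0r; apply: ler_sum => s _; apply: le_harmonic_sum.
  by apply: subset_leq_card; apply: subsetIl.
apply: le_trans IH; set m := score D v in m0 mx.
pose c s := #|cneigh s :&: (cneigh v :&: uncovered D)|.
have cards : #|v |: D|%:R <= #|D|%:R + 1 :> R.
  by rewrite natr1 ler_nat cardsU1 -add1n leq_add2r leq_b1.
(* Choosing v removes [c s] uncovered vertices around s. As m is the maximal score, at most m were
   there, so the summand of s falls by at least [c s] / m. *)
have drop : \sum_(s in S) harmonic_sum (score (v |: D) s) + \sum_(s in S) (c s)%:R / m%:R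
    <= \sum_(s in S) harmonic_sum (score D s).
  rewrite -big_split /=; apply: ler_sum => s _; rewrite (score_setU1 v D s).
  by apply: harmonic_sumD_ge; rewrite -score_setU1.
(* The losses [c s] add up to at least m because S is dominating. *)
have one : 1 <= \sum_(s in S) (c s)%:R / m%:R :> R.
  rewrite -mulr_suml ler_pdivlMr ?ltr0n // mul1r -natr_sum ler_nat.
  exact: score_best_le.
lra.
Qed.

(** The remaining potential is nonnegative, and each summand of the initial one is at most H(Delta +
    1). *)
Lemma greedy_card (G : sgraph) (S D : {set G}) :
  dominating S -> greedy D -> #|D|%:R <= #|S|%:R * harmonic_sum (max_degree G).+1.
Proof.
move=> domS gD; apply: le_trans (_ : \sum_(s in S) harmonic_sum #|cneigh s| <= _).
  apply: le_trans (greedy_potential domS gD); rewrite lerDl.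
  by apply: sumr_ge0 => s _; apply: harmonic_sum_ge0.
rewrite mulr_natl -sumr_const; apply: ler_sum => s _.
by apply/le_harmonic_sum/card_cneigh.
Qed.
End Potential.

(** * The program *)

(* In the expressions below i, j, u and v are levels of loop variables and l is
   the current level, at which the sums bind their variable.  Row i of the
   adjacency matrix is at n i in the array, and the indicator of the set built so
   far at n^2.  Truth values are 0 and 1. *)
Definition EAnd (e f : exp) : exp := ESub e (ESub (ECst 1) f).

(** The sum of n copies of i is the start n i of row i. *)
Definition EAdj (i j : nat) : exp := EArr (EAdd (ESum (EVar i)) (EVar j)).

(** The second summand tests i = j as 1 - |i - j|. Without loops in the graph, the two summands are
    never both 1. *)
Definition ECneigh (i j : nat) : exp :=
  EAdd (EAdj i j)
    (ESub (ECst 1) (EAdd (ESub (EVar i) (EVar j)) (ESub (EVar j) (EVar i)))).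

Definition EPos (v : nat) : exp := EAdd (ESum ESize) (EVar v).

Definition EIn (v : nat) : exp := EArr (EPos v).

(** A truncated difference of 1 and a sum is a bounded universal quantifier: it is 1 when all terms
    vanish and 0 otherwise. *)
Definition EUncovered (l v : nat) : exp :=
  ESub (ECst 1) (ESum (EAnd (EIn l) (ECneigh l v))).

Definition EScore (l v : nat) : exp :=
  ESum (EAnd (ECneigh v l) (EUncovered l.+1 l)).

(** The second argument of the outer [EAnd] is a number rather than a truth value; it acts as the
    test that this number is positive. [EFirst] uses the same device for a strict comparison. *)
Definition EBest (l v : nat) : exp :=
  EAnd (ESub (ECst 1) (ESum (ESub (EScore l.+1 l) (EScore l.+1 v))))
    (EScore l v).

Definition EFirst (l u v : nat) : exp :=
  EAnd (EAdj u v)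
    (ESub (ECst 1) (ESum (EAnd (EAdj u l) (ESub (EVar v) (EVar l))))).

(** The value may exceed 1; printing tests only whether it is 0. *)
Definition EExt (l v : nat) : exp :=
  EAdd (EIn v) (ESum (EAnd (EIn l) (EFirst l.+1 l v))).

Definition read_phase : cmd :=
  CLoop (CLoop (CRead (EAdd (ESum (EVar 0)) (EVar 1)))).

(* Each pass of the outer loop makes a greedy choice as long as some vertex is
   uncovered, so that n passes suffice. *)
Definition greedy_phase : cmd :=
  CLoop (CLoop (CStore (EPos 1) (EAdd (EIn 1) (EBest 2 1)))).

Definition print_phase : cmd := CLoop (CPrint (EExt 1 0) (EVar 0)).

Definition ntds_cmd : cmd := CSeq read_phase (CSeq greedy_phase print_phase).

Lemma foldl_iota_ind (A : Type) (I : nat -> A -> Prop) (f : A -> nat -> A) x n :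
  I 0 x -> (forall k y, k < n -> I k y -> I k.+1 (f y k)) ->
  I n (foldl f x (iota 0 n)).
Proof.
move=> I0; elim: n => // n IHn IS; rewrite foldl_iotaS; apply: (IS) => //.
by apply: IHn => k y /ltnW; apply: IS.
Qed.

Lemma sub1n_sum (T : finType) (F : T -> nat) :
  1 - \sum_x F x = [forall x, F x == 0].
Proof.
have -> : [forall x, F x == 0] = (\sum_x F x == 0) by rewrite sum_nat_eq0.
by case: (\sum_x F x).
Qed.

Lemma nth_allpairs (A B C : Type) (f : A -> B -> C) a0 b0 c0 s t i j :
  i < size s -> j < size t ->
  nth c0 [seq f x y | x <- s, y <- t] (size t * i + j) = f (nth a0 s i) (nth b0 t j).
Proof.
elim: s i => //= x s IHs [|i] li lj; rewrite nth_cat size_map.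
  by rewrite muln0 lj (nth_map b0).
rewrite ltnNge mulnS -addnA leq_addr /= addKn; exact: IHs.
Qed.

(** * Correctness of the program on the encoded graph *)

Section Simulation.
Variable G : sgraph.
Implicit Types (u v w : G) (S D : {set G}) (a : nat -> nat) (env : seq nat).
Let n := #|G|.

Definition binds env l v := l < size env /\ nth 0 env l = enum_rank v.

Lemma binds_rcons env l v x : binds env l v -> binds (rcons env x) l v.
Proof. by move=> [lt eq]; split; rewrite ?size_rcons 1?ltnW // nth_rcons lt. Qed.

Lemma binds_last env l v : size env = l -> binds (rcons env (enum_rank v)) l v.
Proof. by move=> <-; split; rewrite ?size_rcons // nth_rcons ltnn eqxx. Qed.

Definition represents a D :=
  (forall u v, a (n * enum_rank u + enum_rank v) = edge u v) /\
  (forall v, a (n * n + enum_rank v) = (v \in D)).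

(** Reindexing along the bijection [enum_rank] turns sums over indices into sums over vertices. *)
Lemma eval_sum env e a (f : G -> nat) :
  (forall v, eval n (rcons env (enum_rank v)) e a = f v) ->
  eval n env (ESum e) a = \sum_v f v.
Proof.
move=> ef; rewrite /= (reindex (@enum_rank G)) /=; last first.
  exact/onW_bij/enum_rank_bij.
by apply: eq_bigr => v _; rewrite ef.
Qed.

Lemma eval_and env e f a (b c : bool) :
  eval n env e a = b -> eval n env f a = c -> eval n env (EAnd e f) a = b && c.
Proof. by move=> /= -> ->; case: b c => [] []. Qed.

Section Eval.
Variables (a : nat -> nat) (D : {set G}).
Hypothesis aD : represents a D.

Lemma eval_row env i u : binds env i u -> eval n env (ESum (EVar i)) a = n * enum_rank u.
Proof.
move=> bi /=; rewrite (eq_bigr (fun=> enum_rank u : nat)) => [|k _].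
  by rewrite sum_nat_const card_ord.
by have [_ ->] := binds_rcons k bi.
Qed.

Lemma eval_adj env i j u v :
  binds env i u -> binds env j v -> eval n env (EAdj i j) a = edge u v.
Proof.
move=> bi [_ ej]; have := eval_row bi; rewrite /= ej => ->.
by case: aD => ->.
Qed.

Lemma eval_cneigh env i j u v :
  binds env i u -> binds env j v -> eval n env (ECneigh i j) a = (v \in cneigh u).
Proof.
move=> bi bj; have := eval_adj bi bj; rewrite /= => ->.
case: bi bj => _ -> [_ ->]; rewrite !inE.
have [->|neq] := eqVneq v u; first by rewrite edge_irrefl subnn.
have : enum_rank v != enum_rank u :> nat.
  by apply: contra neq => /eqP/val_inj/enum_rank_inj ->.
by case: edge => /=; lia.
Qed.

Lemma eval_pos env l v : binds env l v -> eval n env (EPos l) a = n * n + enum_rank v.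
Proof. by case=> _ /= ->; rewrite sum_nat_const card_ord. Qed.

Lemma eval_in env l v : binds env l v -> eval n env (EIn l) a = (v \in D).
Proof. by move=> /eval_pos /= ->; case: aD => _ ->. Qed.

Lemma eval_uncovered env l i v : size env = l -> binds env i v ->
  eval n env (EUncovered l i) a = (v \in uncovered D).
Proof.
move=> szl bi.
have E : eval n env (ESum (EAnd (EIn l) (ECneigh l i))) a =
    \sum_u ((u \in D) && (v \in cneigh u)).
  apply: eval_sum => u; apply: eval_and; first exact/eval_in/binds_last.
  by apply: eval_cneigh; [apply: binds_last | apply: binds_rcons].
transitivity (1 - \sum_u ((u \in D) && (v \in cneigh u))); first by rewrite -E.
rewrite sub1n_sum inE; congr nat_of_bool; apply/forallP/negP => [h /bigcupP[u uD uv]|h u].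
  by have := h u; rewrite uD uv.
by rewrite eqb0; apply/negP => /andP[uD uv]; apply/h/bigcupP; exists u.
Qed.

Lemma eval_score env l i v : size env = l -> binds env i v ->
  eval n env (EScore l i) a = score D v.
Proof.
move=> szl bi; rewrite /score -sum1_card big_mkcond.
apply: eval_sum => u; rewrite in_setI.
transitivity (nat_of_bool ((u \in cneigh v) && (u \in uncovered D))).
  apply: eval_and.
    by apply: eval_cneigh; [apply: binds_rcons | apply: binds_last].
  by apply: eval_uncovered; [rewrite size_rcons szl | apply: binds_last].
by case: (_ \in _) (_ \in _) => [] [].
Qed.

Lemma eval_best env l i v : size env = l -> binds env i v ->
  eval n env (EBest l i) a = best D v.
Proof.
move=> szl bi.
have E : eval n env (ESum (ESub (EScore l.+1 l) (EScore l.+1 i))) a =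
    \sum_w (score D w - score D v).
  apply: eval_sum => w; congr (_ - _).
    by apply: eval_score; [rewrite size_rcons szl | apply: binds_last].
  by apply: eval_score; [rewrite size_rcons szl | apply: binds_rcons].
transitivity ((1 - \sum_w (score D w - score D v)) - (1 - score D v)).
  by rewrite -E -(eval_score szl bi).
rewrite sub1n_sum /best andbC.
have -> : [forall w, score D w - score D v == 0] = [forall w, score D w <= score D v].
  by apply: eq_forallb.
by case: [forall _, _]; case: (score D v).
Qed.

Lemma eval_first env l i j u v : size env = l -> binds env i u -> binds env j v ->
  eval n env (EFirst l i j) a = first_neigh u v.
Proof.
move=> szl bi bj; apply: eval_and; first exact: eval_adj.
pose F w := edge u w - (1 - (enum_rank v - enum_rank w)).
have E : eval n env (ESum (EAnd (EAdj i l) (ESub (EVar j) (EVar l)))) a = \sum_w F w.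
  apply: eval_sum => w; have bw := binds_last w szl; have bv := binds_rcons (enum_rank w) bj.
  have := eval_adj (binds_rcons (enum_rank w) bi) bw.
  by rewrite /= => ->; case: bw bv => _ -> [_ ->].
transitivity (1 - \sum_w F w); first by rewrite -E.
rewrite sub1n_sum; congr nat_of_bool; apply: eq_forallb => w; rewrite /F.
by case: edge => /=; rewrite ?implybT ?implybF; lia.
Qed.

Lemma eval_ext env l i v : size env = l -> binds env i v ->
  (eval n env (EExt l i) a != 0) = (v \in total_ext D).
Proof.
move=> szl bi.
have E : eval n env (ESum (EAnd (EIn l) (EFirst l.+1 l i))) a =
    \sum_u ((u \in D) && first_neigh u v).
  apply: eval_sum => u; apply: eval_and; first exact/eval_in/binds_last.
  apply: eval_first; first by rewrite size_rcons szl.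
    exact: binds_last.
  exact: binds_rcons.
have -> : eval n env (EExt l i) a =
    (v \in D) + \sum_u ((u \in D) && first_neigh u v).
  by rewrite -E -(eval_in bi).
rewrite addn_eq0 negb_and eqb0 negbK inE; congr (_ || _).
rewrite sum_nat_eq0 negb_forall /=; apply/existsP/bigcupP => [[u]|[u uD]].
  by rewrite /= eqb0 negbK => /andP[uD uv]; exists u; rewrite ?inE.
by rewrite inE => uv; exists u; rewrite uD uv.
Qed.

End Eval.

(** The matrix ends where the indicator of the set begins, so updates of the set leave the matrix
    intact. *)
Lemma entry_lt u v : n * enum_rank u + enum_rank v < n * n.
Proof.
apply: (@leq_trans (n * (enum_rank u).+1)).
  by rewrite mulnS addnC ltn_add2r ltn_ord.
by rewrite leq_mul2l ltn_ord orbT.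
Qed.

Lemma represents_upd a D v (b : bool) : represents a D ->
  represents (upd a (n * n + enum_rank v) ((v \in D) || b))
    (if b then v |: D else D).
Proof.
move=> [aE aD]; split=> [u w|w].
  rewrite upd_neq ?aE // neq_ltn ltn_addr //; exact: entry_lt.
rewrite /upd eqn_add2l val_eqE (inj_eq enum_rank_inj) aD.
case: eqP => [->|/eqP/negPf neq]; case: b => //=; rewrite ?orbF ?orbT ?inE ?neq //.
by rewrite eqxx.
Qed.

Lemma enum_rank_ex i : i < n -> exists v, i = enum_rank v.
Proof. by move=> lt; exists (enum_val (Ordinal lt)); rewrite enum_valK. Qed.

Lemma read_phaseP : exists2 a, represents a set0 &
  sem n [::] read_phase (State (fun=> 0) (behead (encode_graph G)) [::]) = State a [::] [::].
Proof.
set L := behead _.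
have szL : size L = n * n by rewrite size_allpairs -cardE.
(* After k reads the array holds the first k entries and zeros from there on; in the end the zeros
   from n^2 on represent the empty set. *)
pose I k (st : state) := exists a,
  [/\ st = State a (drop k L) [::], forall i, i < k -> a i = nth 0 L i &
      forall i, k <= i -> a i = 0].
have : I (n * n) (sem n [::] read_phase (State (fun=> 0) L [::])).
  apply: (foldl_iota_ind (I := fun k => I (n * k))) => [|i st lti].
    by rewrite muln0; exists (fun=> 0); rewrite drop0.
  rewrite mulnS addnC => -[a [-> aL a0]] /=.
  apply: (foldl_iota_ind (I := fun k => I (n * i + k))) => [|j st' ltj].
    by rewrite addn0; exists a.
  case=> a' [-> aL' a0'] /=; rewrite sum_nat_const card_ord addnS -[behead _]drop1.
  rewrite drop_drop add1n -nth0 nth_drop addn0.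
  eexists; split; first reflexivity.
    move=> k; rewrite ltnS leq_eqVlt /upd; case: eqP => [->|_ /=] //; exact: aL'.
  by move=> k lt; rewrite upd_neq ?a0'; lia.
case=> a [-> aL a0]; exists a; last by rewrite drop_oversize ?szL.
split=> [u v|v]; last by rewrite inE a0 ?leq_addr.
rewrite aL.
  have -> : n = size (enum G) by rewrite -cardE.
  by rewrite (nth_allpairs _ u v) -?cardE ?nth_enum_rank.
exact: entry_lt.
Qed.

Lemma greedy_phaseP a s o : represents a set0 -> exists a' D,
  [/\ represents a' D, greedy D, dominating D &
      sem n [::] greedy_phase (State a s o) = State a' s o].
Proof.
move=> a0.
(* After k passes either everything is covered or at least k vertices have been chosen. *)
pose I k (st : state) := exists a D, [/\ st = State a s o, represents a D,
  greedy D & uncovered D = set0 \/ k <= #|D|].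
have : I n (sem n [::] greedy_phase (State a s o)).
  apply: foldl_iota_ind => [|t st _ [{a0}a [D0 [-> aD0 gD0 tD0]]]].
    by exists a, set0; split=> //; [apply: Greedy0 | right].
  (* While a pass has changed nothing, no vertex visited so far was a best choice. A complete pass
     without change therefore leaves no best choice, hence no uncovered vertex. *)
  pose J k (st : state) := exists a D, [/\ st = State a s o, represents a D,
    greedy D, D0 \subset D &
    D = D0 -> forall v, enum_rank v < k -> ~~ best D0 v].
  have : J n (sem n [:: t] (CLoop (CStore (EPos 1) (EAdd (EIn 1) (EBest 2 1))))
                (State a s o)).
    apply: foldl_iota_ind => [|i {}st /enum_rank_ex[v iv]].
      by exists a, D0.
    case=> {aD0}a [D [-> aD gD sub noD]].
    have bi : binds [:: t; i] 1 v by split.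
    exists (upd a (n * n + enum_rank v) ((v \in D) || best D v)).
    exists (if best D v then v |: D else D); split.
    - rewrite -[rcons _ _]/[:: t; i].
      rewrite -[LHS]/(State (upd a (eval n [:: t; i] (EPos 1) a)
        (eval n [:: t; i] (EIn 1) a + eval n [:: t; i] (EBest 2 1) a)) s o).
      rewrite (eval_pos _ bi) (eval_in aD bi) (eval_best aD _ bi) //.
      by case: (boolP (best D v)) => [/best_notin/negPf ->|_]; rewrite ?addn0 ?orbF.
    - exact: represents_upd.
    - by case: ifP => // bv; apply: GreedyU.
    - by case: ifP => // _; apply: subset_trans sub (subsetUr _ _).
    case: ifP => [bv vD|/negbT nbv eqD w].
      by move: (best_notin bv); rewrite (subsetP sub) // -vD setU11.
    rewrite ltnS leq_eqVlt => /predU1P[|]; last exact: noD.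
    by rewrite iv => /val_inj/enum_rank_inj ->; rewrite -eqD.
  case=> a' [D [E aD gD sub noD]]; exists a', D; split=> //.
  have [eqD|neD] := eqVneq D D0.
    left; apply/eqP/negPn/negP => /exists_best[v]; rewrite eqD.
    by apply/negP/(noD eqD)/ltn_ord.
  case: tD0 => [u0|tD0]; [left|right].
    by apply/eqP; rewrite -subset0 -u0; apply: uncoveredS.
  apply: leq_ltn_trans tD0 (proper_card _).
  by rewrite properEneq eq_sym neD sub.
case=> a' [D [E aD gD cov]]; exists a', D; split=> //.
rewrite dominatingE; case: cov => [->|le] //.
(* With n chosen vertices the set is everything, so it also covers everything. *)
have -> : D = [set: G] by apply/eqP; rewrite eqEcard subsetT cardsT.
by rewrite uncovered_setT.
Qed.

(** Visiting indices in increasing order follows [enum G], so the printing loop produces the order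
    required by [encode_set]. *)
Lemma iota_enum_rank : iota 0 n = [seq nat_of_ord (enum_rank v) | v <- enum G].
Proof.
apply: (@eq_from_nth _ 0) => [|i]; first by rewrite size_iota size_map -cardE.
rewrite size_iota => lt; have [v iv] := enum_rank_ex lt.
by rewrite nth_iota // (nth_map v) -?cardE // add0n iv nth_enum_rank.
Qed.

Lemma print_phaseP a D s : represents a D ->
  sout (sem n [::] print_phase (State a s [::])) = encode_set (total_ext D).
Proof.
move=> aD; pose p i := eval n [:: i] (EExt 1 0) a != 0.
have : sem n [::] print_phase (State a s [::]) = State a s [seq i <- iota 0 n | p i].
  apply: (foldl_iota_ind (I := fun k st => st = State a s [seq i <- iota 0 k | p i])) => //.
  move=> k st _ ->; rewrite -[k.+1]addn1 iotaD filter_cat.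
  rewrite -[LHS]/(if eval n [:: k] (EExt 1 0) a == 0 then _ else _).
  rewrite -[eval _ _ _ _ == 0]negbK -/(p k) if_neg add0n /=.
  by case: ifP => _; rewrite ?cats0 // cats1.
move=> ->; rewrite /= iota_enum_rank filter_map /encode_set.
congr map; rewrite [RHS]/enum_mem -enumT; apply: eq_filter => v /=.
by rewrite -(@eval_ext a D aD [:: nat_of_ord (enum_rank v)] 1 0 v).
Qed.

Lemma ntds_cmdP : exists D, [/\ greedy D, dominating D &
  sout (sem n [::] ntds_cmd (State (fun=> 0) (behead (encode_graph G)) [::])) =
    encode_set (total_ext D)].
Proof.
have [a a0 E] := read_phaseP.
have [a' [D [aD gD dD E']]] := greedy_phaseP [::] [::] a0.
exists D; split=> //.
rewrite -[sem _ _ _ _]/(sem n [::] (CSeq greedy_phase print_phase)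
  (sem n [::] read_phase (State _ _ _))) E.
rewrite -[sem _ _ _ _]/(sem n [::] print_phase
  (sem n [::] greedy_phase (State _ _ _))) E'.
exact: print_phaseP.
Qed.

End Simulation.

(* Harmonic numbers against the logarithm, and the approximation ratio *)
From mathcomp Require Import all_classical all_reals all_analysis.
Import Order.TTheory GRing.Theory Num.Theory.

Local Open Scope ring_scope.

Lemma harmonic_sum_le_ln (R : realType) (n : nat) :
  harmonic_sum R n.+1 <= ln (n%:R + 1) + 1.
Proof.
elim: n => [|n IHn].
  by rewrite /harmonic_sum big_ord1 add0r ln1 add0r invr1.
rewrite /harmonic_sum big_ord_recr /= -/(harmonic_sum _ _).
have x0 : 0 < n.+1%:R + 1 :> R by rewrite natr1 ltr0n.
have y0 : 0 < n%:R + 1 :> R by rewrite natr1 ltr0n.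
have lnxy : ln (n.+1%:R + 1) - ln (n%:R + 1) = ln ((n.+1%:R + 1) / (n%:R + 1)) :> R.
  by rewrite ln_div ?posrE.
(* The inequality e^(-x) >= 1 - x at x = ln((n+2)/(n+1)) reads (n+1)/(n+2) >= 1 - x, that is,
   1/(n+2) <= ln(n+2) - ln(n+1): the new harmonic term is at most the growth of the logarithm. *)
have := expR_ge1Dx (- ln ((n.+1%:R + 1) / (n%:R + 1) : R)).
rewrite expRN lnK ?posrE ?divr_gt0 // invf_div -lnxy => h.
have e : (n%:R + 1) / (n.+1%:R + 1) = 1 - n.+2%:R^-1 :> R.
  rewrite -[n.+2%:R]natr1 -[n.+1%:R]natr1.
  by field; rewrite !natr1 pnatr_eq0.
rewrite e in h; move: h IHn {lnxy e}.
by move: (ln _) (ln _) (harmonic_sum _ _) (_^-1) => a b c d; lra.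
Qed.

Theorem theorem25 :
  exists P : program,
    poly_time encode_graph P /\
    forall (R : realType) (G : sgraph), exists D : {set G},
      [/\ outputs P (encode_graph G) (encode_set D),
          ntds D &
          #|D|%:R <= 2 * (ln ((max_degree G)%:R + 1) + 1) * (gamma_nt G)%:R :> R].
Proof.
exists (compile ntds_cmd); split; first exact: compile_poly_time.
move=> R G; have [D [gD dD E]] := ntds_cmdP G.
exists (total_ext D); split; last 1 first.
(* A minimum neighborhood total dominating set is in particular dominating, so it can serve as the
   set against which the greedy choice is measured. *)
- have [S /andP[dS _] <-] := gamma_nt_attained G.
  apply: (@le_trans _ _ (2 * #|D|%:R)).
    by rewrite -natrM ler_nat card_total_ext.
  rewrite -mulrA ler_pM2l ?ltr0n // mulrC.
  apply: le_trans (greedy_card R dS gD) _.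
  by rewrite ler_wpM2l // harmonic_sum_le_ln.
- have [t _ [H Eo]] := @compileP ntds_cmd #|G| (behead (encode_graph G)) erefl.
  by exists t; rewrite Eo.
- exact: ntds_total_ext.
Qed.
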